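(* Let $d \ge 1$ be an integer and let ${\cal A}_d \subset \mathbb{Z}^2$ be an optimal tristance anticode of diameter $d$ in the grid graph ${\cal G}_2$. Then $$|{\cal A}_d| = \left\lceil \frac{2d^2+6d+4}{7}\right\rceil = \left\lceil \frac{2(d+1)(d+2)}{7}\right\rceil .$$ Moreover, up to rotation by an angle of $\pi/2$ and translation, ${\cal A}_d = {\mathscr O}(a,b,c)$, where $(a,b,c)$ is determined by $r = d \bmod 7$ as follows: $r=0$: $(a,b,c)=(\tfrac{4d}{7},\tfrac{4d}{7},\tfrac{d}{7})$; $r=1$: $(\tfrac{4d+3}{7},\tfrac{4d-4}{7},\tfrac{d-1}{7})$; $r=2$: $(\tfrac{4d-1}{7},\tfrac{4d-1}{7},\tfrac{d-2}{7})$; $r=3$: $(\tfrac{4d+2}{7},\tfrac{4d-5}{7},\tfrac{d-3}{7})$; $r=4$: $(\tfrac{4d-2}{7},\tfrac{4d-2}{7},\tfrac{d-4}{7})$; $r=5$: $(a,b,c)$ is one of $(\tfrac{4d+1}{7},\tfrac{4d+1}{7},\tfrac{d+2}{7})$ or $(\tfrac{4d+1}{7},\tfrac{4d-6}{7},\tfrac{d-5}{7})$; $r=6$: $(a,b,c)$ is one of $(\tfrac{4d-3}{7},\tfrac{4d-3}{7},\tfrac{d-6}{7})$ or $(\tfrac{4d+4}{7},\tfrac{4d-3}{7},\tfrac{d+1}{7})$.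
   Context: The grid graph ${\cal G}_2$ has vertex set $\mathbb{Z}^2$, with $z,z'$ adjacent iff their $L_1$-distance is $1$. For $z_1,z_2,z_3\in\mathbb{Z}^2$, the tristance $d_3(z_1,z_2,z_3)$ is the minimum number of edges of a tree in ${\cal G}_2$ (which may use additional vertices) containing $z_1,z_2,z_3$. A set ${\cal A}\subset\mathbb{Z}^2$ is a tristance anticode of diameter $d$ if $d_3(z_1,z_2,z_3)\le d$ for all $z_1,z_2,z_3\in{\cal A}$; it is optimal if it has the largest possible cardinality among tristance anticodes of diameter $d$. For integers $a,b,c$, ${\mathscr O}(a,b,c)$ denotes the set of $(x,y)\in\mathbb{Z}^2$ with $0\le x\le a$, $0\le y\le b$, $c\le x+y\le a+b-c$, $c-b\le x-y\le a-c$. *)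

(* Defs.v *)
From HB Require Import structures.
From mathcomp Require Import all_boot all_order all_algebra finmap.
From mathcomp Require Import boolp classical_sets cardinality.

Set Implicit Arguments.
Unset Strict Implicit.
Unset Printing Implicit Defensive.

Import Order.TTheory GRing.Theory Num.Theory.

Local Open Scope fset_scope.
Local Open Scope ring_scope.

Definition Z2 : choiceType := (int * int)%type.

Definition L1dist (z z' : Z2) : int := `|z.1 - z'.1| + `|z.2 - z'.2|.

Definition grid_adj : rel Z2 := [rel z z' | L1dist z z' == 1].

(* A finite subgraph is a pair (V, E); an edge is the unordered pair
   [fset u; v] of its endpoints. *)
Definition grid_subgraph (V : {fset Z2}) (E : {fset {fset Z2}}) : Prop :=
  forall e, e \in E ->
    exists u v, [/\ e = [fset u; v], u \in V, v \in V & grid_adj u v].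

Definition edge_rel (E : {fset {fset Z2}}) : rel Z2 :=
  [rel u v | [fset u; v] \in E].

Definition walk_between (E : {fset {fset Z2}}) (u v : Z2) : Prop :=
  exists p : seq Z2, path (edge_rel E) u p /\ last u p = v.

Definition graph_connected (V : {fset Z2}) (E : {fset {fset Z2}}) : Prop :=
  forall u v, u \in V -> v \in V -> walk_between E u v.

Definition graph_acyclic (E : {fset {fset Z2}}) : Prop :=
  forall c : seq Z2, (2 < size c)%N -> uniq c -> ~~ cycle (edge_rel E) c.

Definition grid_tree (V : {fset Z2}) (E : {fset {fset Z2}}) : Prop :=
  [/\ grid_subgraph V E, graph_connected V E & graph_acyclic E].

Definition spanned_by_tree (z1 z2 z3 : Z2) (n : nat) : Prop :=
  exists V E, [/\ grid_tree V E, z1 \in V, z2 \in V, z3 \in V & #|` E| = n].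

Lemma grid_adj_neq u v : grid_adj u v -> u != v.
Proof.
by apply: contraTneq => ->; rewrite /grid_adj /= /L1dist !subrr.
Qed.

Lemma edge_sym E : symmetric (edge_rel E).
Proof. by move=> x y; rewrite /edge_rel /= fsetUC. Qed.

Lemma walk_sym E x y : walk_between E x y -> walk_between E y x.
Proof.
case=> p [ep <-]; exists (rev (belast x p)); split.
  by rewrite rev_path; under eq_path => a b do rewrite edge_sym.
by case: p {ep} => [|a p] //=; rewrite rev_cons last_rcons.
Qed.

Lemma walk_trans E x y z :
  walk_between E x y -> walk_between E y z -> walk_between E x z.
Proof.
move=> [p [ep lp]] [q [eq lq]]; exists (p ++ q).
by rewrite cat_path last_cat lp ep eq.
Qed.

Lemma grid_tree1 z : grid_tree [fset z] fset0.
Proof.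
split=> [e|u v|]; first by rewrite in_fset0.
  by rewrite !in_fset1 => /eqP-> /eqP->; exists [::].
case=> [|x [|y c]] // _ _; rewrite /= /edge_rel /=.
Qed.

Lemma grid_tree_leaf V E u w : grid_tree V E -> u \in V -> w \notin V ->
  grid_adj u w -> grid_tree (w |` V) ([fset u; w] |` E).
Proof.
move=> [sVE cVE aE] uV wV uw; have nuw := grid_adj_neq uw.
have EV x y : [fset x; y] \in E -> x \in V.
  move=> /sVE[a [b [eab aV bV _]]].
  have : x \in [fset x; y] by rewrite !inE eqxx.
  by rewrite eab !inE => /orP[]/eqP->.
have wE x : edge_rel ([fset u; w] |` E) w x -> x = u.
  rewrite /edge_rel /= in_fset1U => /orP[/eqP h|/EV]; last by rewrite (negPf wV).
  have : x \in [fset u; w] by rewrite -h !inE eqxx orbT.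
  rewrite !inE => /orP[]/eqP // xw.
  have : u \in [fset w; x] by rewrite h !inE eqxx.
  by rewrite xw !inE orbb (negPf nuw).
have sub x y : edge_rel E x y -> edge_rel ([fset u; w] |` E) x y.
  by rewrite /edge_rel /= in_fset1U => ->; rewrite orbT.
split.
- move=> e; rewrite in_fset1U => /orP[/eqP->|/sVE[a [b [-> aV bV ab]]]].
    by exists u, w; split; rewrite // !inE ?eqxx ?uV ?orbT.
  by exists a, b; split; rewrite // !inE ?aV ?bV orbT.
- have from_u x : x \in w |` V -> walk_between ([fset u; w] |` E) u x.
    rewrite in_fset1U => /orP[/eqP->|xV].
      by exists [:: w]; rewrite /= /edge_rel /= in_fset1U eqxx.
    have [p [ep lp]] := cVE u x uV xV.
    by exists p; split=> //; apply: sub_path ep.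
  by move=> x y /from_u/walk_sym ux /from_u; apply: walk_trans.
- move=> c c2 cU; apply/negP => cc.
  have [wc|wc] := boolP (w \in c).
    have [i c' rc] := rot_to wc.
    move: cc cU c2; rewrite -(rot_cycle i) -(rot_uniq i) -(size_rot i) rc.
    case/lastP: c' {rc} => [|s y] //; case: s => [|x s] //=.
    rewrite rcons_path => /andP[/wE -> /andP[_]].
    rewrite last_rcons edge_sym => /wE -> /andP[_].
    by rewrite mem_rcons inE eqxx.
  have /negP := aE c c2 cU; apply.
  apply: sub_in_cycle cc; last by apply/allP => x; exact: id.
  move=> x y xc yc; rewrite /edge_rel /= in_fset1U => /orP[/eqP h|//].
  have : w \in [fset x; y] by rewrite h !inE eqxx orbT.
  by rewrite !inE => /orP[]/eqP wxy; move: wc; rewrite wxy ?xc ?yc.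
Qed.

Lemma grid_path (x y : Z2) : exists p, path grid_adj x p /\ last x p = y.
Proof.
have [n] := ubnP `|L1dist x y|%N; elim: n x => // n IHn x.
rewrite ltnS => le_n.
have step x' : grid_adj x x' -> L1dist x' y = L1dist x y - 1 ->
    exists p, path grid_adj x p /\ last x p = y.
  move=> xx' dd; have [|p [pp lp]] := IHn x'; last first.
    by exists (x' :: p); rewrite /= xx'.
  apply: leq_trans le_n; rewrite -ltz_nat !gez0_abs ?addr_ge0 //.
  by rewrite dd gtrDl.
case: x y step {IHn le_n} => [x1 x2] [y1 y2]; rewrite /L1dist /= => step.
have h (a b : int) : a != b ->
    exists2 e : int, `|e| = 1 & `|a + e - b| = `|a - b| - 1.
  rewrite neq_lt => /orP[ab|ba].
    exists 1; rewrite // addrAC ler0_norm ?ltr0_norm ?subr_lt0 //.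
      by rewrite opprD.
    by rewrite lezD1 subr_lt0.
  exists (- 1); rewrite // addrAC ger0_norm ?gtr0_norm ?subr_gt0 //.
  by rewrite subr_ge0 -gtz0_ge1 subr_gt0.
have [e1|/h[e e1 he]] := eqVneq x1 y1.
  have [e2|/h[e e12 he]] := eqVneq x2 y2.
    by exists [::]; rewrite /= e1 e2.
  apply: (step (x1, x2 + e)) => /=.
    by rewrite /grid_adj /= /L1dist /= opprD addNKr normrN e12 subrr normr0.
  by rewrite he addrA.
apply: (step (x1 + e, x2)) => /=.
  by rewrite /grid_adj /= /L1dist /= opprD addNKr normrN e1 subrr normr0.
by rewrite he addrAC.
Qed.

Lemma grid_tree_add V E u z : grid_tree V E -> u \in V ->
  exists V' E', [/\ grid_tree V' E', {subset V <= V'} & z \in V'].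
Proof.
have [p [pp <-]] := grid_path u z.
elim: p u V E pp => [|w p IHp] u V E /= pp tVE uV; first by exists V, E; split.
case/andP: pp => uw pp.
have [wV|wV] := boolP (w \in V); first exact: IHp pp tVE wV.
have wwV : w \in w |` V by rewrite !inE eqxx.
have [V' [E' [t s zV']]] := IHp _ _ _ pp (grid_tree_leaf tVE uV wV uw) wwV.
by exists V', E'; split=> // x xV; apply: s; rewrite !inE xV orbT.
Qed.

Lemma spanned_by_tree_ex z1 z2 z3 : exists n, `[< spanned_by_tree z1 z2 z3 n >].
Proof.
have z1V : z1 \in [fset z1] by rewrite inE.
have [V [E [t s z2V]]] := grid_tree_add z2 (grid_tree1 z1) z1V.
have [V' [E' [t' s' z3V]]] := grid_tree_add z3 t z2V.
exists #|` E'|; apply/asboolP; exists V', E'; split=> //; last exact: s'.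
by apply/s'/s.
Qed.

Definition tristance (z1 z2 z3 : Z2) : nat :=
  ex_minn (spanned_by_tree_ex z1 z2 z3).

Definition tristance_anticode (d : nat) (A : set Z2) : Prop :=
  forall z1 z2 z3, A z1 -> A z2 -> A z3 -> (tristance z1 z2 z3 <= d)%N.

Definition optimal_tristance_anticode (d : nat) (A : set Z2) : Prop :=
  tristance_anticode d A /\ forall B, tristance_anticode d B -> (B #<= A)%card.

Local Open Scope classical_set_scope.
Local Open Scope ring_scope.

Definition octagon (a b c : int) : set Z2 :=
  [set z : Z2 | [/\ 0 <= z.1 <= a, 0 <= z.2 <= b,
               c <= z.1 + z.2 <= a + b - c & c - b <= z.1 - z.2 <= a - c]].

Definition translate (t z : Z2) : Z2 := (z.1 + t.1, z.2 + t.2).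

Definition rotate90 (z : Z2) : Z2 := (- z.2, z.1).

Definition eq_up_to_rot_trans (A B : set Z2) : Prop :=
  exists t, A = translate t @` B \/ A = translate t @` (rotate90 @` B).

(* Every division below is exact for d in the stated residue class. *)
Definition optimal_params (d : nat) : seq (int * int * int) :=
  let q (m k : int) := ((m * d%:Z + k) %/ 7)%Z in
  match (d %% 7)%N with
  | 0%N => [:: (q 4 0, q 4 0, q 1 0)]
  | 1%N => [:: (q 4 3, q 4 (- 4), q 1 (- 1))]
  | 2%N => [:: (q 4 (- 1), q 4 (- 1), q 1 (- 2))]
  | 3%N => [:: (q 4 2, q 4 (- 5), q 1 (- 3))]
  | 4%N => [:: (q 4 (- 2), q 4 (- 2), q 1 (- 4))]
  | 5%N => [:: (q 4 1, q 4 1, q 1 2); (q 4 1, q 4 (- 6), q 1 (- 5))]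
  | _ => [:: (q 4 (- 3), q 4 (- 3), q 1 (- 6)); (q 4 4, q 4 (- 3), q 1 1)]
  end.

(* Main.v *)
Require Import Defs.
From HB Require Import structures.
From mathcomp Require Import all_boot all_order all_algebra finmap.
From mathcomp Require Import boolp classical_sets cardinality zify ring lra.
Import Order.TTheory GRing.Theory Num.Theory.
Local Open Scope ring_scope.

(* The tristance of three points is the half-perimeter of their bounding box:
   every vertical and horizontal line separating them is crossed by a tree edge,
   and three shortest paths from the coordinatewise median attain the bound.
   One of three points always lies at a corner of their bounding box, so an
   anticode with an a x b bounding box satisfies a + b - d <= x + y <= d and
   a - d <= x - y <= d - b: it lies in the octagon with c = a + b - d, which is
   itself an anticode. As the anticode touches the four sides of its bounding
   box, 2c <= min(a, b), so for c >= 0 the four corners cut off are disjoint and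
   the octagon has (a + 1)(b + 1) - 2c(c + 1) points. Completing the square in
   this count leaves, for each residue of d mod 7, only the listed maximizers. *)

(** * Lower bound on tristance: edges crossing separating lines *)

Lemma fset2_sum (f : Z2 -> int) (u v : Z2) : u != v ->
  \sum_(z <- [fset u; v]%fset) f z = f u + f v.
Proof.
move=> nuv; rewrite big_fsetU1 /=; last by rewrite inE.
by rewrite big_seq_fset1.
Qed.

Lemma grid_adj_cases {u v : Z2} : grid_adj u v ->
  (`|u.1 - v.1| = 1 /\ u.2 = v.2) \/ (u.1 = v.1 /\ `|u.2 - v.2| = 1).
Proof.
case: u v => [x y] [x' y']; rewrite /grid_adj /L1dist /= => /eqP.
lia.
Qed.

(* The sum of f over the endpoints of an edge records which level k + 1/2 the
   edge crosses, as the odd number 2k + 1; it is even if f is constant on it. *)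
Lemma walk_crosses {f : Z2 -> int} {V E} {u v : Z2} {k : int} :
    (forall x y, grid_adj x y -> `|f x - f y| <= 1) ->
    grid_subgraph V E -> walk_between E u v -> f u <= k < f v ->
  exists2 e, e \in E & \sum_(z <- e) f z = 2 * k + 1.
Proof.
move=> f1 sVE [p []]; elim: p u => [|w p IHp] u /= pE lp kuv.
  by subst v; lia.
move: pE => /andP[uw pE].
have [kw|wk] := leP (f w) k; first by apply: (IHp w) => //; lia.
exists [fset u; w]%fset; first exact: uw.
have [a [b [eab _ _ ab]]] := sVE _ uw.
have nab := grid_adj_neq ab; have := f1 _ _ ab.
have nuw : u != w by apply/eqP => uw'; subst w; lia.
have : \sum_(z <- [fset u; w]%fset) f z = \sum_(z <- [fset a; b]%fset) f z by rewrite eab.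
have ua : u \in [fset a; b]%fset by rewrite -eab !inE eqxx.
have wa : w \in [fset a; b]%fset by rewrite -eab !inE eqxx orbT.
rewrite !fset2_sum // => eq1 fab.
move: ua wa; rewrite !inE => /orP[]/eqP ? /orP[]/eqP ?; subst; lia.
Qed.

(** Distinct levels between [f u] and [f v] give distinct odd edge sums, hence distinct edges.
    Counting by parity alone makes the counts for the two coordinates comparable. *)
Lemma crossing_edges {f : Z2 -> int} {V E} {u v : Z2} :
    (forall x y, grid_adj x y -> `|f x - f y| <= 1) ->
    grid_subgraph V E -> walk_between E u v ->
  f v - f u <= (count (fun e : {fset Z2} => odd `|(\sum_(z <- e) f z)%R|%N) E)%:Z.
Proof.
move=> f1 sVE uv; have [le|lt] := leP (f v) (f u); first by lia.
set P := fun e : {fset Z2} => odd `|(\sum_(z <- e) f z)%R|%N.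
pose s := [seq 2 * (f u + i%:Z) + 1 | i <- iota 0 (absz (f v - f u))].
have us : uniq s by rewrite map_inj_uniq ?iota_uniq // => i j; lia.
have : {subset s <= [seq \sum_(z <- e : {fset Z2}) f z | e <- enum_fset E & P e]}.
  have crossed (i : nat) : (i < absz (f v - f u))%N ->
      exists2 e, e \in E & \sum_(z <- e) f z = 2 * (f u + i%:Z) + 1.
    by move=> ilt; apply: (walk_crosses f1 sVE uv); lia.
  move=> x /mapP[i]; rewrite mem_iota => /crossed[e eE ee] ->.
  rewrite -ee; apply: map_f; rewrite mem_filter eE andbT /P ee.
  by move: (f u) i {ee} => y; lia.
move=> /(uniq_leq_size us); rewrite !size_map size_iota size_filter.
by move: (count _ _) (f u) (f v) lt => n x y; lia.
Qed.

Lemma tristance_ge (z1 z2 z3 p q r s : Z2) :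
    p \in [:: z1; z2; z3] -> q \in [:: z1; z2; z3] ->
    r \in [:: z1; z2; z3] -> s \in [:: z1; z2; z3] ->
  (q.1 - p.1) + (s.2 - r.2) <= (tristance z1 z2 z3)%:Z.
Proof.
move=> hp hq hr hs; rewrite /tristance; case: ex_minnP => n /asboolP.
move=> [V [E [[sVE cVE _] z1V z2V z3V <-]]] _.
have inV x : x \in [:: z1; z2; z3] -> x \in V.
  by rewrite !inE => /or3P[]/eqP->.
have lip1 x y : grid_adj x y -> `|x.1 - y.1| <= 1 by move/grid_adj_cases; lia.
have lip2 x y : grid_adj x y -> `|x.2 - y.2| <= 1 by move/grid_adj_cases; lia.
have hx := crossing_edges lip1 sVE (cVE _ _ (inV _ hp) (inV _ hq)).
have hy := crossing_edges lip2 sVE (cVE _ _ (inV _ hr) (inV _ hs)).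
set P := fun e : {fset Z2} => odd `|(\sum_(z <- e) z.1)%R|%N in hx.
set Q := fun e : {fset Z2} => odd `|(\sum_(z <- e) z.2)%R|%N in hy.
apply: le_trans (lerD hx hy) _; rewrite -PoszD lez_nat.
(* A grid edge changes exactly one coordinate, so no edge satisfies both [P] and [Q], and the two
   counts add up to at most the number of edges. *)
rewrite -count_predUI (_ : count (predI P Q) E = 0)%N ?addn0 ?count_size //.
apply/eqP; rewrite eqn0Ngt -has_count; apply/hasPn => e /sVE[a [b [-> _ _ ab]]].
rewrite /P /Q /= !fset2_sum ?grid_adj_neq //.
move: (grid_adj_cases ab) => {ab}; case: a b => [x y] [x' y'] /=; lia.
Qed.

(** * Upper bound on tristance: trees grown from the median *)

Lemma grid_step (u z : Z2) : u != z ->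
  exists2 w, grid_adj u w & L1dist w z = L1dist u z - 1.
Proof.
case: u z => [x y] [x' y']; rewrite xpair_eqE => h.
rewrite /grid_adj /L1dist /=.
have [xx|xx] := ltP x x'; first by exists (x + 1, y) => /=; lia.
have [yy|yy] := ltP y y'; first by exists (x, y + 1) => /=; lia.
have [xx2|xx2] := ltP x' x; first by exists (x - 1, y) => /=; lia.
by exists (x, y - 1) => /=; lia.
Qed.

(** On a shortest path to [z], a new vertex is attached as a leaf for one edge, and a vertex already
    in the tree costs nothing. *)
Lemma grid_tree_extend {V E} {u : Z2} (z : Z2) : grid_tree V E -> u \in V ->
  exists V' E', [/\ grid_tree V' E', {subset V <= V'}, z \in V' &
    (#|` E'|)%:Z <= (#|` E|)%:Z + L1dist u z].
Proof.
have [n] := ubnP `|L1dist u z|%N; elim: n u V E => // n IHn u V E.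
rewrite ltnS => le_n tVE uV; have [<-|/grid_step[w uw dw]] := eqVneq u z.
  by exists V, E; split=> //; rewrite /L1dist; lia.
have lt_n : (`|L1dist w z| < n)%N by move: dw le_n; rewrite /L1dist; lia.
have [wV|wV] := boolP (w \in V).
  have [V' [E' [t s zV' cE]]] := IHn w V E lt_n tVE wV.
  by exists V', E'; split=> //; lia.
have wwV : w \in (w |` V)%fset by rewrite !inE eqxx.
have [V' [E' [t s zV' cE]]] := IHn _ _ _ lt_n (grid_tree_leaf tVE uV wV uw) wwV.
exists V', E'; split=> //; first by move=> x xV; apply: s; rewrite !inE xV orbT.
by move: cE; rewrite cardfsU1; lia.
Qed.

Lemma tristance_le (z1 z2 z3 m : Z2) :
  (tristance z1 z2 z3)%:Z <= L1dist m z1 + L1dist m z2 + L1dist m z3.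
Proof.
have mV : m \in [fset m]%fset by rewrite inE.
have [V1 [E1 [t1 s1 zV1 c1]]] := grid_tree_extend z1 (grid_tree1 m) mV.
have [V2 [E2 [t2 s2 zV2 c2]]] := grid_tree_extend z2 t1 (s1 _ mV).
have [V3 [E3 [t3 s3 zV3 c3]]] := grid_tree_extend z3 t2 (s2 _ (s1 _ mV)).
move: c1; rewrite cardfs0 => c1.
rewrite /tristance; case: ex_minnP => n _ /(_ #|` E3|%fset) min_n.
suff : (n <= #|` E3|)%N by lia.
apply: min_n; apply/asboolP; exists V3, E3; split=> //; last exact: s3.
by apply/s3/s2.
Qed.

Lemma median3 {T : eqType} (f : T -> int) (z1 z2 z3 : T) :
  exists m p q, [/\ p \in [:: z1; z2; z3], q \in [:: z1; z2; z3] &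
    `|m - f z1| + `|m - f z2| + `|m - f z3| = f q - f p].
Proof.
have [xy|xy] := leP (f z1) (f z2); have [yz|yz] := leP (f z2) (f z3);
have [xz|xz] := leP (f z1) (f z3).
all: first [ by exists (f z2), z1, z3; rewrite !inE !eqxx ?orbT; split=> //; lia
    | by exists (f z2), z3, z1; rewrite !inE !eqxx ?orbT; split=> //; lia
    | by exists (f z1), z2, z3; rewrite !inE !eqxx ?orbT; split=> //; lia
    | by exists (f z1), z3, z2; rewrite !inE !eqxx ?orbT; split=> //; lia
    | by exists (f z3), z1, z2; rewrite !inE !eqxx ?orbT; split=> //; lia
    | by exists (f z3), z2, z1; rewrite !inE !eqxx ?orbT; split=> //; lia ].
Qed.

Lemma tristance_bbox (z1 z2 z3 : Z2) (d : int) :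
    (forall p q r s, p \in [:: z1; z2; z3] -> q \in [:: z1; z2; z3] ->
       r \in [:: z1; z2; z3] -> s \in [:: z1; z2; z3] ->
       (q.1 - p.1) + (s.2 - r.2) <= d) ->
  (tristance z1 z2 z3)%:Z <= d.
Proof.
have [m1 [p [q [hp hq e1]]]] := median3 fst z1 z2 z3.
have [m2 [r [s [hr hs e2]]]] := median3 snd z1 z2 z3.
move=> /(_ _ _ _ _ hp hq hr hs); rewrite -e1 -e2; apply: le_trans.
apply: le_trans (tristance_le _ _ _ (m1, m2)) _.
by rewrite /L1dist /=; lia.
Qed.

(** * Counting the points of an octagon *)

(* Number of points of the row y removed at each end: the two truncated
   differences account for the lower and the upper corners. *)
Definition row_cut (b c y : nat) : nat := (c - y) + (y + c - b).

Definition octagon_seq (a b c : nat) : seq Z2 :=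
  [seq ((x%:Z, y%:Z) : Z2) | y <- index_iota 0 b.+1,
     x <- iota (row_cut b c y) (a.+1 - (row_cut b c y).*2)].

Lemma octagon_seq_uniq a b c : uniq (octagon_seq a b c).
Proof.
apply: allpairs_uniq_dep.
- exact: iota_uniq.
- by move=> y _; exact: iota_uniq.
- by move=> [y x] [y' x'] _ _ /= [-> ->].
Qed.

Lemma mem_octagon_seq (a b c : nat) (z : Z2) : (c.*2 <= a)%N -> (c.*2 <= b)%N ->
  reflect (octagon a b c z) (z \in octagon_seq a b c).
Proof.
move=> ca cb; case: z => [x y]; apply: (iffP allpairsPdep).
  move=> [n [m []]]; rewrite mem_index_iota mem_iota /row_cut => hn hm [-> ->].
  by rewrite /octagon /=; split; lia.
rewrite /octagon /= => -[hx hy hs hd].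
exists (absz y), (absz x); rewrite mem_index_iota mem_iota /row_cut; split; try lia.
by congr pair; lia.
Qed.

Lemma sum_row_cut (b c : nat) : (c.*2 <= b)%N ->
  (\sum_(0 <= y < b.+1) row_cut b c y = c * c.+1)%N.
Proof.
have tri (m n : nat) : (m <= n)%N -> (2 * \sum_(0 <= y < n) (m - y) = m * m.+1)%N.
  elim: n m => [|n IHn] m mn; first by rewrite big_geq //; lia.
  case: m mn => [|m] mn; first by rewrite big1.
  rewrite big_nat_recl // (eq_bigr (fun y => m - y)%N) => [|y _]; last exact: subSS.
  by rewrite mulnDr IHn //; nia.
move=> cb; rewrite big_split /=.
(* Reversing the rows turns the upper corners into lower ones, so both sums are the same triangular
   number. *)
rewrite [X in (_ + X)%N]big_nat_rev /=.
under [X in (_ + X)%N]eq_big_nat => y hy.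
  rewrite (_ : _ - b = c - y)%N; last by lia.
  over.
have := tri c b.+1; lia.
Qed.

Lemma size_octagon_seq (a b c : nat) : (c.*2 <= a)%N -> (c.*2 <= b)%N ->
  (size (octagon_seq a b c) + 2 * (c * c.+1) = a.+1 * b.+1)%N.
Proof.
move=> ca cb; rewrite size_allpairs_dep sumnE big_map -(sum_row_cut _ _ cb).
rewrite big_distrr -big_split /=.
under eq_big_seq => y.
  rewrite mem_index_iota size_iota => hy.
  (* [2c <= b] keeps the lower and upper cuts from meeting in one row, so the cut is at most [c];
     then [2c <= a] keeps the row length from truncating. *)
  rewrite (_ : (_ + _)%N = a.+1); last by rewrite /row_cut; lia.
  over.
by rewrite big_const_seq count_predT size_iota subn0 iter_addn_0.
Qed.

(** * Maximizing the count over the parameters *)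

(** The triples of [optimal_params] at [d = 7 * k + r], with the divisions carried out. *)
Definition params7 (k : int) (r : nat) : seq (int * int * int) :=
  match r with
  | 0%N => [:: (4 * k, 4 * k, k)]
  | 1%N => [:: (4 * k + 1, 4 * k, k)]
  | 2%N => [:: (4 * k + 1, 4 * k + 1, k)]
  | 3%N => [:: (4 * k + 2, 4 * k + 1, k)]
  | 4%N => [:: (4 * k + 2, 4 * k + 2, k)]
  | 5%N => [:: (4 * k + 3, 4 * k + 3, k + 1); (4 * k + 3, 4 * k + 2, k)]
  | _ => [:: (4 * k + 3, 4 * k + 3, k); (4 * k + 4, 4 * k + 3, k + 1)]
  end.

Lemma optimal_params_div (d : nat) :
  optimal_params d = params7 (d %/ 7)%N%:Z (d %% 7).
Proof.
have qE (m i v : int) :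
    m * (d %% 7)%N%:Z + i = 7 * v -> ((m * d%:Z + i) %/ 7)%Z = m * (d %/ 7)%N%:Z + v.
  move=> h; rewrite {1}(divn_eq d 7) PoszD PoszM mulrDr -addrA h.
  by rewrite mulrA -(mulrC 7) -mulrDr mulKz.
rewrite /optimal_params; have := ltn_pmod d (isT : 0 < 7)%N.
move: (d %% 7)%N qE => r qE.
have {}qE (m i v : int) : (m * r%:Z + i - 7 * v) = 0 -> ((m * d%:Z + i) %/ 7)%Z = m * (d %/ 7)%N%:Z + v.
  by move/eqP; rewrite subr_eq0 => /eqP/qE.
case: r qE => [|[|[|[|[|[|[|r]]]]]]] qE r7 /=; last by lia.
- by rewrite (qE 4 0 0) // (qE 1 0 0) // !addr0 mul1r.
- by rewrite (qE 4 3 1) // (qE 4 (- 4) 0) // (qE 1 (- 1) 0) // !addr0 mul1r.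
- by rewrite (qE 4 (- 1) 1) // (qE 1 (- 2) 0) // !addr0 mul1r.
- by rewrite (qE 4 2 2) // (qE 4 (- 5) 1) // (qE 1 (- 3) 0) // !addr0 mul1r.
- by rewrite (qE 4 (- 2) 2) // (qE 1 (- 4) 0) // !addr0 mul1r.
- by rewrite (qE 4 1 3) // (qE 1 2 1) // (qE 4 (- 6) 2) // (qE 1 (- 5) 0) // !addr0 !mul1r.
- by rewrite (qE 4 (- 3) 3) // (qE 1 (- 6) 0) // (qE 4 4 4) // (qE 1 1 1) // !addr0 !mul1r.
Qed.

Lemma sqr_lt_bounds (R : realDomainType) (x y : R) :
  0 <= y -> x ^+ 2 < y ^+ 2 -> - y < x < y.
Proof.
move=> y0; rewrite -(real_normK (num_real x)) ltr_pXn2r ?nnegrE //.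
by rewrite ltr_norml.
Qed.

(* With e := 7c - d + 2 and c = a + b - d, one has
   28 * size = 8d^2 + 24d + 32 - e^2 - 7(a - b)^2. *)
Lemma octagon_params (a b c : int) (d n : nat) :
    0 <= a -> 0 <= b -> c = a + b - d%:Z ->
    n%:Z = (a + 1) * (b + 1) - 2 * (Num.max c 0 * (Num.max c 0 + 1)) ->
    2 * d%:Z ^+ 2 + 6 * d%:Z + 4 <= 7 * n%:Z ->
  [/\ 7 * n%:Z <= 2 * d%:Z ^+ 2 + 6 * d%:Z + 10, 0 <= c &
    (a, b, c) \in optimal_params d \/ (b, a, c) \in optimal_params d].
Proof.
move=> a0 b0 ec en hn.
(* If [c < 0], then [a + b < d] and the count is [(a + 1) * (b + 1)], at most [(d + 1)^2 / 4]; seven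
   times this is below [2 * (d + 1) * (d + 2)], against [hn]. *)
have c0 : 0 <= c.
  rewrite leNgt; apply/negP => c0.
  have en' : n%:Z = (a + 1) * (b + 1) by rewrite en; lia.
  have : (a + b + 2) ^+ 2 <= (d%:Z + 1) ^+ 2 by rewrite lerXn2r ?nnegrE; lia.
  have : 0 <= (a - b) ^+ 2 by exact: sqr_ge0.
  by nia.
have {}en : n%:Z = (a + 1) * (b + 1) - 2 * (c * (c + 1)) by rewrite en; lia.
pose e : int := 7 * c - d%:Z + 2; pose f : int := a - b.
have key : 28 * n%:Z = 8 * d%:Z ^+ 2 + 24 * d%:Z + 32 - e ^+ 2 - 7 * f ^+ 2.
  rewrite en /e /f (_ : d%:Z = a + b - c); first by ring.
  by rewrite ec; ring.
(* Four times [hn] leaves at most 32 - 16 for the quadratic form, so only finitely many [e] and [f]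
   remain. *)
have ef : e ^+ 2 + 7 * f ^+ 2 <= 16 by lia.
have e2 := sqr_ge0 e; have f2 := sqr_ge0 f.
have /andP[e4 e4'] : - 5 < e < 5 by apply: sqr_lt_bounds => //; lia.
have /andP[f1 f1'] : - 2 < f < 2 by apply: sqr_lt_bounds => //; lia.
split=> //; first by lia.
rewrite optimal_params_div.
have dE : d%:Z = 7 * (d %/ 7)%N%:Z + (d %% 7)%N%:Z by lia.
have r7 : (d %% 7 < 7)%N by rewrite ltn_pmod.
move: (d %/ 7)%N (d %% 7)%N dE r7 => k r dE r7.
have {}dE : a + b - c = 7 * k%:Z + r%:Z by lia.
have fE : f = a - b by [].
have eE : e = 7 * c - (a + b - c) + 2 by rewrite /e ec; lia.
clearbody e f.
clear d hn n en key ef e2 f2 ec.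
have hf : f = - 1 \/ f = 0 \/ f = 1 by lia.
case: r r7 dE => [|[|[|[|[|[|[|r]]]]]]] // _ dE /=.
(* Here [7 * c = 7 * k + (r + e - 2)] with [r + e - 2] between -6 and 8, so this remainder is 0 or
   7. Then [c] and [f] determine [a] and [b]. *)
all: have : c = k \/ c = k%:Z + 1 by lia.
all: case=> cE; subst c; case: hf => [|[]] hf; try (exfalso; lia).
all: rewrite !inE !xpair_eqE; lia.
Qed.

Lemma octagon_optimal_size (d : nat) : exists a b c : nat,
  [/\ (c.*2 <= a)%N, (c.*2 <= b)%N, (a + b = d + c)%N &
    (2 * d ^ 2 + 6 * d + 4 + 7 * (2 * (c * c.+1)) <= 7 * (a.+1 * b.+1))%N].
Proof.
have dE : d = (7 * (d %/ 7) + d %% 7)%N by lia.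
have r7 : (d %% 7 < 7)%N by rewrite ltn_pmod.
move: (d %/ 7)%N (d %% 7)%N dE r7 => k r -> r7.
(* The member of [params7 k r] with [c = k]: the sides are as equal as [a + b = 8 * k + r]
   allows. *)
exists (4 * k + uphalf r)%N, (4 * k + r./2)%N, k; split; [lia|lia|lia|].
by case: r r7 => [|[|[|[|[|[|[|r]]]]]]] // _ /=; nia.
Qed.

(** * Octagons as anticodes, and anticodes inside octagons *)

Lemma in_translate (t : Z2) (A : set Z2) (z : Z2) :
  (translate t @` A)%classic z <-> A (z.1 - t.1, z.2 - t.2).
Proof.
case: t z => [t1 t2] [x y]; split=> [[[x' y'] Axy [<- <-]]|Axy] /=.
  by rewrite !addrK.
by exists (x - t1, y - t2); rewrite // /translate /= !subrK.
Qed.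

Lemma card_translate_octagon (t : Z2) (a b c : nat) :
    (c.*2 <= a)%N -> (c.*2 <= b)%N ->
  let T := (translate t @` octagon a b c)%classic in
  finite_set T /\ (#|` fset_set T|%fset + 2 * (c * c.+1) = a.+1 * b.+1)%N.
Proof.
move=> ca cb T; pose s := map (translate t) (octagon_seq a b c).
have inj_t : injective (translate t).
  by case: t @T @s => t1 t2 _ _ [x y] [x' y'] [/addIr-> /addIr->].
have -> : T = [set` [fset z in s]%fset]%classic.
  apply/seteqP; split=> z /=; rewrite inE /=.
    by move=> [w /(mem_octagon_seq _ _ _ _ ca cb) ws <-]; apply: map_f.
  by move=> /mapP[w /(mem_octagon_seq _ _ _ _ ca cb) ws ->]; exists w.
split; first exact: finite_fset.
rewrite set_fsetK card_fseq undup_id ?(map_inj_uniq inj_t) ?octagon_seq_uniq //.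
by rewrite size_map size_octagon_seq.
Qed.

Lemma octagon_anticode (d : nat) (t : Z2) (a b c : nat) :
    (c <= a)%N -> (c <= b)%N -> (a + b <= d + c)%N ->
  tristance_anticode d (translate t @` octagon a b c)%classic.
Proof.
move=> ca cb abd z1 z2 z3 z1T z2T z3T.
rewrite -lez_nat; apply: tristance_bbox => p q r s hp hq hr hs.
have oct z : z \in [:: z1; z2; z3] -> octagon a b c (z.1 - t.1, z.2 - t.2).
  by rewrite !inE => /or3P[]/eqP->; apply/in_translate.
(* By pigeonhole two of the four points coincide. Either one difference vanishes and the other is at
   most [a] or [b], or the common point enters both differences and a diagonal constraint bounds
   their sum by [a + b - c]. *)
have : ~~ uniq [:: p; q; r; s].
  apply/negP => u4.
  suff /(uniq_leq_size u4) : {subset [:: p; q; r; s] <= [:: z1; z2; z3]} by [].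
  by apply/allP; rewrite /= hp hq hr hs.
move: (oct _ hp) (oct _ hq) (oct _ hr) (oct _ hs).
rewrite /octagon /= !inE !negb_and !negb_or /= !negbK.
case: t {oct z1T z2T z3T} => t1 t2 /=.
case: p {hp} => [px py]; case: q {hq} => [qx qy].
case: r {hr} => [rx ry]; case: s {hs} => [sx sy]; rewrite !xpair_eqE /=.
move=> [? ? ? ?] [? ? ? ?] [? ? ? ?] [? ? ? ?] ; lia.
Qed.

Lemma exists_maximizer {T : Type} (A : set T) (f : T -> int) (M : int) (z0 : T) :
  A z0 -> (forall z, A z -> f z <= M) ->
  exists2 z, A z & forall w, A w -> f w <= f z.
Proof.
move=> Az0 fM; have [n] := ubnP `|M - f z0|%N.
elim: n z0 Az0 => // n IHn z Az; rewrite ltnS => le_n.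
have [max_z|] := pselect (forall w, A w -> f w <= f z); first by exists z.
move=> /existsNP[w /not_implyP[Aw /negP]]; rewrite -ltNge => zw.
by apply: (IHn w Aw); have := fM _ Az; have := fM _ Aw; lia.
Qed.

Lemma anticode_sub_octagon (d : nat) (A : set Z2) (z0 : Z2) :
    tristance_anticode d A -> A z0 ->
  exists t (a b : nat), let c := (a + b - d)%N in
    [/\ (c.*2 <= a)%N, (c.*2 <= b)%N & (A `<=` translate t @` octagon a b c)%classic].
Proof.
move=> Ad Az0.
have bound u v w p q r s : A u -> A v -> A w ->
    p \in [:: u; v; w] -> q \in [:: u; v; w] ->
    r \in [:: u; v; w] -> s \in [:: u; v; w] ->
    (q.1 - p.1) + (s.2 - r.2) <= d%:Z.
  move=> Au Av Aw hp hq hr hs; apply: le_trans (tristance_ge _ _ _ _ _ _ _ hp hq hr hs) _.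
  by rewrite lez_nat; apply: Ad.
(* The point [w] enters both differences; the four sign patterns correspond to the four corners of
   the bounding box. *)
have b1 u v w : A u -> A v -> A w -> (u.1 - w.1) + (v.2 - w.2) <= d%:Z.
  by move=> Au Av Aw; apply: (bound u v w); rewrite // !inE eqxx ?orbT.
have b2 u v w : A u -> A v -> A w -> (u.1 - w.1) + (w.2 - v.2) <= d%:Z.
  by move=> Au Av Aw; apply: (bound u v w); rewrite // !inE eqxx ?orbT.
have b3 u v w : A u -> A v -> A w -> (w.1 - u.1) + (v.2 - w.2) <= d%:Z.
  by move=> Au Av Aw; apply: (bound u v w); rewrite // !inE eqxx ?orbT.
have b4 u v w : A u -> A v -> A w -> (w.1 - u.1) + (w.2 - v.2) <= d%:Z.
  by move=> Au Av Aw; apply: (bound u v w); rewrite // !inE eqxx ?orbT.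
have [E AE maxE] : exists2 z, A z & forall w, A w -> w.1 <= z.1.
  apply: (exists_maximizer A fst (z0.1 + d%:Z) z0) => // z Az.
  by have := b1 _ _ _ Az Az0 Az0; lia.
have [N AN maxN] : exists2 z, A z & forall w, A w -> w.2 <= z.2.
  apply: (exists_maximizer A snd (z0.2 + d%:Z) z0) => // z Az.
  by have := b1 _ _ _ Az0 Az Az0; lia.
have [W AW minW] : exists2 z, A z & forall w, A w -> - w.1 <= - z.1.
  apply: (exists_maximizer A (fun z => - z.1) (d%:Z - z0.1) z0) => // z Az.
  by have := b3 _ _ _ Az Az0 Az0; lia.
have [S AS minS] : exists2 z, A z & forall w, A w -> - w.2 <= - z.2.
  apply: (exists_maximizer A (fun z => - z.2) (d%:Z - z0.2) z0) => // z Az.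
  by have := b2 _ _ _ Az0 Az Az0; lia.
have WE := maxE _ AW; have SN := maxN _ AS.
pose a := absz (E.1 - W.1); pose b := absz (N.2 - S.2).
have aE : a%:Z = E.1 - W.1 by rewrite /a; lia.
have bE : b%:Z = N.2 - S.2 by rewrite /b; lia.
clearbody a b.
have ineqs z : A z -> [/\ E.1 - z.1 + (N.2 - z.2) <= d%:Z,
    E.1 - z.1 + (z.2 - S.2) <= d%:Z, z.1 - W.1 + (N.2 - z.2) <= d%:Z &
    z.1 - W.1 + (z.2 - S.2) <= d%:Z].
  by move=> Az; split; [apply: b1|apply: b2|apply: b3|apply: b4].
(* Truncation gives [c = 0] when [a + b <= d]; the octagon is then the whole bounding box. *)
exists (W.1, S.2), a, b => c; split.
(* At the lowest point two of the inequalities add up to [a + 2 * b <= 2 * d], which gives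
   [2 * c <= a]. *)
- by have [] := ineqs _ AS; rewrite /c; lia.
- by have [] := ineqs _ AW; rewrite /c; lia.
move=> z Az; apply/in_translate; have [] := ineqs _ Az.
have := maxE _ Az; have := maxN _ Az; have := minW _ Az; have := minS _ Az.
case: z {Az} => x y; rewrite /octagon /c /=.
move: W.1 E.1 S.2 N.2 aE bE => w e s n aE bE h1 h2 h3 h4 h5 h6 h7 h8.
by split; lia.
Qed.

(** * Rotation and conclusion *)

(** A quarter turn moves the octagon with swapped sides into the columns from [-a] to 0, hence the
    shift by [a]. This handles triples listed only with [a] and [b] exchanged. *)
Lemma octagon_rotate (t : Z2) (a b c : int) :
  (translate t @` octagon a b c)%classic
  = (translate (t.1 + a, t.2) @` (rotate90 @` octagon b a c))%classic.
Proof.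
case: t => t1 t2; apply/seteqP; split=> [z /in_translate|z /in_translate [[x y]]] /=.
  case: z => x y; rewrite /octagon /= => -[h1 h2 h3 h4].
  apply/in_translate; exists (y - t2, a - (x - t1)) => /=.
    by rewrite /octagon /=; split; lia.
  by rewrite /rotate90 /=; congr pair; lia.
case: z => x' y'; rewrite /octagon /= => -[h1 h2 h3 h4] [e1 e2].
by apply/in_translate; rewrite /octagon /=; split; lia.
Qed.

Lemma card_le_fset_set (A B : set Z2) : finite_set A -> finite_set B ->
  (A #<= B)%card -> (#|` fset_set A|%fset <= #|` fset_set B|%fset)%N.
Proof.
move=> [n An] finB AB; rewrite (card_fset_set An).
by apply: leq_card_fset_set => //; rewrite -(card_le_eql An).
Qed.

Theorem theorem15 (d : nat) (hd : (1 <= d)%N) (A : set Z2)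
    (hA : optimal_tristance_anticode d A) :
  [/\ finite_set A,
      (#|` fset_set A|%fset)%:Z
        = Num.ceil ((2 * d%:Q ^+ 2 + 6 * d%:Q + 4) / 7),
      Num.ceil ((2 * d%:Q ^+ 2 + 6 * d%:Q + 4) / 7)
        = Num.ceil (2 * (d%:Q + 1) * (d%:Q + 2) / 7)
    & exists a b c : int, (a, b, c) \in optimal_params d /\
        eq_up_to_rot_trans A (octagon a b c)].
Proof.
have [Ad maxA] := hA.
have [a0 [b0 [c0 [ca0 cb0 ab0 size0]]]] := octagon_optimal_size d.
have [finT0 cardT0] := card_translate_octagon (0, 0) _ _ _ ca0 cb0.
have T0A : (translate (0, 0) @` octagon a0 b0 c0 #<= A)%card.
  by apply/maxA/octagon_anticode; lia.
set T0 := (translate (0, 0) @` _)%classic in finT0 cardT0 T0A.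
have [z0 Az0] : exists z, A z.
  apply: contrapT => /forallNP A0; have A0' : A = set0 by rewrite -subset0.
  move: T0A cardT0 size0; rewrite A0' card_le0 => /eqP->.
  by rewrite fset_set0 cardfs0; lia.
have [t [a [b []]]] := anticode_sub_octagon d A z0 Ad Az0.
set c := (a + b - d)%N => ca cb AT.
have [finT cardT] := card_translate_octagon t _ _ _ ca cb.
have TA : (translate t @` octagon a b c #<= A)%card.
  by apply/maxA/octagon_anticode; rewrite /c in ca cb *; lia.
set T := (translate t @` _)%classic in finT cardT AT TA.
have finA : finite_set A := sub_finite_set AT finT.
(* [T] is itself an anticode, so it is no larger than the optimal [A] that it contains; for finite
   sets this forces equality. *)
have eAT : A = T.
  apply: fset_set_inj => //; apply/eqP; rewrite eqEfcard.
  by rewrite card_le_fset_set // andbT -fset_set_sub.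
have := card_le_fset_set _ _ finT0 finA T0A; rewrite eAT => leT.
have {size0} lo : 2 * d%:Z ^+ 2 + 6 * d%:Z + 4 <= 7 * (#|` fset_set T|%fset)%:Z.
  by move: leT size0 cardT0; move: (c0 * c0.+1)%N (a0.+1 * b0.+1)%N; lia.
have [//|//|//| | //|ub c0' params] :=
  octagon_params a b (a%:Z + b%:Z - d%:Z) d #|` fset_set T|%fset.
  by rewrite (_ : Num.max _ 0 = c%:Z); [lia|rewrite /c; lia].
have cE : a%:Z + b%:Z - d%:Z = c%:Z by rewrite /c; lia.
rewrite cE in params.
split=> //.
(* [lo] and [ub] confine seven times the cardinality to a window of length 6 above the numerator, so
   rounding up is exact. *)
- apply/esym/ceil_def; move: lo ub.
  rewrite -!(ler_int rat) !rmorphD !rmorphM /= rmorphN /= => lo ub.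
  by apply/andP; split; lra.
- by congr Num.ceil; ring.
case: params => params; first by exists a, b, c; split=> //; exists t; left.
exists b, a, c; split=> //; exists (t.1 + a%:Z, t.2); right.
exact: octagon_rotate.
Qed.
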